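(* Let $\mathcal{H}_A,\mathcal{H}_B$ be complex Hilbert spaces of finite dimensions $d_A\le d_B$, let $\{G^A_\alpha\}_{\alpha=0}^{d_A^2-1}$ and $\{G^B_\beta\}_{\beta=0}^{d_B^2-1}$ be canonical bases of $\mathcal{B}(\mathcal{H}_A)$ and $\mathcal{B}(\mathcal{H}_B)$, and let $\rho$ be a density operator on $\mathcal{H}_A\otimes\mathcal{H}_B$ with canonical correlation matrix $C^{\rm can}_{\alpha\beta}=\mathrm{Tr}(\rho\, G^A_\alpha\otimes G^B_\beta)$. If $\rho$ is separable, then for arbitrary real $x,y\ge 0$ $$\| D^A_x\, C^{\rm can}\, D^B_y \|_{\rm tr} \;\le\; \mathcal{N}_A(x)\,\mathcal{N}_B(y),$$ where $$\mathcal{N}_A(x)=\sqrt{\frac{d_A-1+x^2}{d_A}},\qquad \mathcal{N}_B(y)=\sqrt{\frac{d_B-1+y^2}{d_B}}.$$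
   Context: A density operator is a positive semidefinite operator of trace one. A density operator $\rho$ on $\mathcal{H}_A\otimes\mathcal{H}_B$ is separable if $\rho=\sum_k p_k\,\rho^A_k\otimes\rho^B_k$ (a finite sum) with $(p_k)$ a probability distribution and $\rho^A_k,\rho^B_k$ density operators on $\mathcal{H}_A,\mathcal{H}_B$. A canonical basis of $\mathcal{B}(\mathcal{H})$ (with $\dim\mathcal{H}=d$) is a basis $\{G_\alpha\}_{\alpha=0}^{d^2-1}$ of Hermitian operators, orthonormal for the Hilbert-Schmidt inner product $\langle X|Y\rangle_{\rm HS}=\mathrm{Tr}(X^\dagger Y)$, with $G_0=\mathbb{1}/\sqrt{d}$. $D^A_x=\mathrm{diag}\{x,1,\dots,1\}$ is the $d_A^2\times d_A^2$ diagonal matrix, and $D^B_y=\mathrm{diag}\{y,1,\dots,1\}$ is the $d_B^2\times d_B^2$ diagonal matrix (the first entry corresponds to index $0$). The trace norm is $\|X\|_{\rm tr}=\mathrm{Tr}\sqrt{XX^\dagger}$, the sum of the singular values of $X$. *)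

(* Defs.v *)
From HB Require Import structures.
From mathcomp Require Import all_boot all_order all_algebra.
From mathcomp Require Import sesquilinear spectral.
From mathcomp.real_closed Require Export complex mxtens.
From mathcomp Require Export reals.

Set Implicit Arguments.
Unset Strict Implicit.
Unset Printing Implicit Defensive.

Import Order.TTheory GRing.Theory Num.Theory.
Local Open Scope ring_scope.
Local Open Scope sesquilinear_scope.

(* A Hilbert space of dimension d is C^d with its standard inner product, and  *)
(* B(C^d) is 'M[C]_d acting on column vectors.  B(C^m (x) C^n) is 'M[C]_(m * n)*)
(* with the Kronecker product A *t B as tensor product of operators.           *)
(* In a numClosedFieldType, 0 <= z means that z is real and nonnegative.       *)
Section Operators.
Context {C : numClosedFieldType}.

Definition psdmx n (A : 'M[C]_n) : Prop :=
  A \is hermsymmx /\ forall v : 'cV[C]_n, 0 <= (v ^t* *m A *m v) 0 0.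

Definition density n (rho : 'M[C]_n) : Prop := psdmx rho /\ \tr rho = 1.

Definition separable m n (rho : 'M[C]_(m * n)) : Prop :=
  exists (K : nat) (p : 'I_K -> C) (rhoA : 'I_K -> 'M[C]_m)
         (rhoB : 'I_K -> 'M[C]_n),
    [/\ forall k, 0 <= p k,
        \sum_k p k = 1,
        forall k, density (rhoA k),
        forall k, density (rhoB k)
      & rho = \sum_k p k *: (rhoA k *t rhoB k)].

Definition hs_inner n (X Y : 'M[C]_n) : C := \tr (X ^t* *m Y).

Definition canonical_basis d (G : 'I_(d ^ 2) -> 'M[C]_d) : Prop :=
  [/\ basis_of fullv [seq G a | a : 'I_(d ^ 2)],
      forall a, G a \is hermsymmx,
      forall a b, hs_inner (G a) (G b) = (a == b)%:R
    & forall a, val a = 0%N -> G a = (sqrtC d%:R)^-1 *: 1%:M].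

Definition can_corr dA dB (GA : 'I_(dA ^ 2) -> 'M[C]_dA)
    (GB : 'I_(dB ^ 2) -> 'M[C]_dB) (rho : 'M[C]_(dA * dB)) :
    'M[C]_(dA ^ 2, dB ^ 2) :=
  \matrix_(a, b) \tr (rho *m (GA a *t GB b)).

Definition diag_first d (x : C) : 'M[C]_(d ^ 2) :=
  diag_mx (\row_a (if val a == 0%N then x else 1)).

(* Functional calculus through the spectral decomposition; meaningful for     *)
(* positive semidefinite A, for which sqrtmx A is the positive semidefinite    *)
(* square root of A (sqrtmx_psd, sqrtmx_sqr).                                  *)
Definition sqrtmx n (A : 'M[C]_n) : 'M[C]_n :=
  invmx (spectralmx A) *m diag_mx (map_mx sqrtC (spectral_diag A))
    *m spectralmx A.

Lemma hermsymmxP n (A : 'M[C]_n) : reflect (A = A ^t*) (A \is hermsymmx).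
Proof.
by apply: (iffP (is_hermitianmxP _ _ _)); rewrite expr0 scale1r.
Qed.

Lemma form_diag n (v : 'cV[C]_n) (d : 'rV[C]_n) :
  (v ^t* *m diag_mx d *m v) 0 0 = \sum_i d 0 i * `|v i 0| ^+ 2.
Proof.
rewrite mxE; apply: eq_bigr => i _; rewrite mul_mx_diag !mxE normCK.
by rewrite mulrAC mulrC [_^* * _]mulrC.
Qed.

Lemma psdmx_mulmxt m n (X : 'M[C]_(m, n)) : psdmx (X *m X ^t*).
Proof.
split; first by apply/hermsymmxP; rewrite trmx_mul map_mxM trmxCK.
move=> v; set w := v ^t* *m X.
have -> : v ^t* *m (X *m X ^t*) *m v = w *m w ^t*.
  by rewrite /w trmx_mul map_mxM trmxCK !mulmxA.
rewrite mxE sumr_ge0// => i _; rewrite !mxE.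
exact: mul_conjC_ge0.
Qed.

Lemma spectral_decomp n (A : 'M[C]_n) : A \is hermsymmx ->
  A = (spectralmx A) ^t* *m diag_mx (spectral_diag A) *m spectralmx A.
Proof.
move=> /hermitian_normalmx /orthomx_spectralP.
by rewrite invmx_unitary ?spectral_unitarymx.
Qed.

Lemma spectral_diag_ge0 n (A : 'M[C]_n) i : psdmx A ->
  0 <= spectral_diag A 0 i.
Proof.
move=> [Ah Apos]; set P := spectralmx A.
have := Apos (P ^t* *m delta_mx i 0); rewrite {1}(spectral_decomp Ah) -/P.
have PP : P *m P ^t* = 1%:M by apply/unitarymxP/spectral_unitarymx.
rewrite trmx_mul map_mxM trmxCK !mulmxA.
rewrite -[X in X *m _ *m P]mulmxA PP mulmx1.
rewrite -[X in X *m delta_mx i 0]mulmxA PP mulmx1 form_diag (bigD1 i)//= big1.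
  by rewrite !mxE !eqxx normr1 expr1n mulr1 addr0.
by move=> j /negPf ji; rewrite !mxE ji normr0 expr0n mulr0.
Qed.

Lemma sqrtmx_psd n (A : 'M[C]_n) : psdmx A -> psdmx (sqrtmx A).
Proof.
move=> Apsd; rewrite /sqrtmx invmx_unitary ?spectral_unitarymx//.
set P := spectralmx A; set D := map_mx sqrtC _.
have D_ge0 i : 0 <= D 0 i by rewrite mxE sqrtC_ge0 spectral_diag_ge0.
split.
  apply/hermsymmxP; rewrite !trmx_mul !map_mxM trmxCK !mulmxA.
  rewrite tr_diag_mx map_diag_mx.
  suff -> : map_mx Num.conj D = D by [].
  by apply/rowP => i; rewrite mxE geC0_conj.
move=> v; have -> : v ^t* *m (P ^t* *m diag_mx D *m P) *m v =
    (P *m v) ^t* *m diag_mx D *m (P *m v).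
  by rewrite trmx_mul map_mxM !mulmxA.
by rewrite form_diag sumr_ge0// => i _; rewrite mulr_ge0// exprn_ge0.
Qed.

Lemma sqrtmx_sqr n (A : 'M[C]_n) : psdmx A -> sqrtmx A *m sqrtmx A = A.
Proof.
move=> [/hermitian_normalmx/orthomx_spectralP Aeq _]; rewrite [RHS]Aeq /sqrtmx.
rewrite !mulmxA mulmxK ?spectral_unit//; congr (_ *m _).
rewrite -mulmxA; congr (_ *m _).
rewrite mulmx_diag; congr diag_mx.
by apply/rowP => i; rewrite !mxE -expr2 sqrtCK.
Qed.

Definition trace_norm m n (X : 'M[C]_(m, n)) : C := \tr (sqrtmx (X *m X ^t*)).

End Operators.

Definition local_bound (R : rcfType) (d : nat) (x : R) : R :=
  Num.sqrt ((d%:R - 1 + x ^+ 2) / d%:R).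

(* Main.v *)
(* The trace norm of X is Tr (X W) for some contraction W, so by Cauchy-Schwarz
   a convex combination of matrices a b^T has trace norm at most the product of
   bounds on |a| and |b|.  For separable rho the correlation matrix is the convex
   combination of the outer products of the local coefficient vectors
   (Tr (rho_k G_a))_a.  By Bessel's inequality their squared length is at most
   Tr rho_k^2 <= 1; the 0th coefficient is 1 / sqrt d, so rescaling it by x
   bounds the squared length by 1 - 1/d + x^2/d. *)
Require Import Defs.
From HB Require Import structures.
From mathcomp Require Import all_boot all_order all_algebra.
From mathcomp Require Import sesquilinear spectral.

Set Implicit Arguments.
Unset Strict Implicit.
Unset Printing Implicit Defensive.

Import Order.TTheory GRing.Theory Num.Theory.
Local Open Scope ring_scope.

(** * Duality for the trace norm *)

Section TraceNorm.
Context {C : numClosedFieldType}.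
Local Open Scope sesquilinear_scope.

Lemma cv_sqnormE n (v : 'cV[C]_n) :
  (v ^t* *m v) 0 0 = \sum_i `|v i 0| ^+ 2.
Proof.
by rewrite mxE; apply: eq_bigr => i _; rewrite !mxE normCKC.
Qed.

(** The pairing is bilinear, without conjugation, to match outer products [a *m b^T]; conjugating
    one vector leaves its length unchanged. *)
Lemma cv_CauchySchwarz n (u v : 'cV[C]_n) :
  `|(u^T *m v) 0 0| ^+ 2 <= (u ^t* *m u) 0 0 * (v ^t* *m v) 0 0.
Proof.
have /= := (CauchySchwarz (@dotmx C n) u^T (v ^t*)).1.
rewrite !dotmxE trmxCK; congr (_ <= _ * _).
by rewrite !mxE; apply: eq_bigr => i _; rewrite !mxE mulrC.
Qed.

Lemma sqrtmx_trE n (A : 'M[C]_n) :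
  \tr (sqrtmx A) = \sum_i sqrtC (spectral_diag A 0 i).
Proof.
rewrite /sqrtmx mxtrace_mulC mulmxA mulmxV ?spectral_unit// mul1mx.
by rewrite mxtrace_diag; apply: eq_bigr => i _; rewrite mxE.
Qed.

Lemma trace_norm_ge0 m n (X : 'M[C]_(m, n)) : 0 <= trace_norm X.
Proof.
rewrite /trace_norm sqrtmx_trE sumr_ge0// => i _.
by rewrite sqrtC_ge0 spectral_diag_ge0//; apply: psdmx_mulmxt.
Qed.

(* The witness is [X^* S^+] with [S^+] the pseudo-inverse of [sqrt (X X^* )],
   which the convention [0^-1 = 0] provides eigenvalue by eigenvalue. *)
Lemma trace_norm_dual m n (X : 'M[C]_(m, n)) :
  exists2 W : 'M[C]_(n, m), \tr (X *m W) = trace_norm X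
    & forall v : 'cV_m, ((W *m v) ^t* *m (W *m v)) 0 0 <= (v ^t* *m v) 0 0.
Proof.
have Apsd := psdmx_mulmxt X; set A := X *m X ^t* in Apsd.
set P := spectralmx A; set d := spectral_diag A.
have d_ge0 i : 0 <= d 0 i by apply: spectral_diag_ge0.
have PP : P *m P ^t* = 1%:M by apply/unitarymxP/spectral_unitarymx.
have PtP : P ^t* *m P = 1%:M by apply: mulmx1C.
have AE : A = P ^t* *m diag_mx d *m P by apply: spectral_decomp; case: Apsd.
pose e := \row_i (sqrtC (d 0 i))^-1.
pose Q := P ^t* *m diag_mx e *m P.
have Qh : Q ^t* = Q.
  rewrite /Q !trmx_mul !map_mxM trmxCK mulmxA tr_diag_mx map_diag_mx.
  suff -> : map_mx Num.conj e = e by [].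
  by apply/rowP => i; rewrite !mxE geC0_conj// invr_ge0 sqrtC_ge0.
have AQE (B : 'M_m) : A *m (P ^t* *m B) = P ^t* *m (diag_mx d *m B).
  by rewrite AE -!mulmxA [P *m (P ^t* *m B)]mulmxA PP mul1mx.
exists (X ^t* *m Q).
  rewrite mulmxA -/A /Q -[P ^t* *m _ *m _]mulmxA AQE mxtrace_mulC.
  rewrite -!mulmxA PP mulmx1.
  rewrite mulmx_diag mxtrace_diag /trace_norm -/A sqrtmx_trE -/d.
  apply: eq_bigr => i _; rewrite !mxE.
  have [->|d0] := eqVneq (d 0 i) 0; first by rewrite sqrtC0 mul0r.
  by rewrite -{1}[d 0 i]sqrtCK expr2 mulfK// sqrtC_eq0.
move=> v; set w := P *m v.
have -> : (X ^t* *m Q *m v) ^t* *m (X ^t* *m Q *m v) =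
    w ^t* *m diag_mx (\row_i (e 0 i * d 0 i * e 0 i)) *m w.
  have QAQ : Q *m A *m Q = P ^t* *m diag_mx (\row_i (e 0 i * d 0 i * e 0 i)) *m P.
    rewrite -[LHS]mulmxA {2}/Q -[P ^t* *m _ *m _]mulmxA AQE /Q -!mulmxA.
    rewrite [P *m (P ^t* *m _)]mulmxA PP mul1mx [diag_mx d *m _]mulmxA.
    rewrite mulmx_diag [diag_mx e *m _]mulmxA mulmx_diag.
    by congr (_ *m (diag_mx _ *m _)); apply/rowP => i; rewrite !mxE mulrA.
  have -> : (X ^t* *m Q *m v) ^t* = v ^t* *m Q *m X.
    by rewrite 2!trmx_mul 2!map_mxM trmxCK Qh mulmxA.
  have -> : v ^t* *m Q *m X *m (X ^t* *m Q *m v) = v ^t* *m (Q *m A *m Q) *m v.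
    by rewrite /A !mulmxA.
  by rewrite QAQ /w trmx_mul map_mxM !mulmxA.
have -> : v ^t* *m v = w ^t* *m w.
  by rewrite /w trmx_mul map_mxM -!mulmxA [P ^t* *m _]mulmxA PtP mul1mx.
(* In the eigenbasis the squared length of [W *m v] has weights [e_i d_i e_i], equal to 1 where
   [d_i] is nonzero and to 0 on the kernel: [W] is a partial isometry. *)
rewrite form_diag cv_sqnormE ler_sum// => i _.
rewrite ler_piMl ?exprn_ge0// !mxE.
have [->|d0] := eqVneq (d 0 i) 0; first by rewrite mulr0 mul0r ler01.
rewrite -{2}[d 0 i]sqrtCK expr2 mulrA mulVf ?sqrtC_eq0// mul1r.
by rewrite mulfV ?sqrtC_eq0.
Qed.

Lemma trace_norm_convex_le m n K (p : 'I_K -> C) (a : 'I_K -> 'cV[C]_m)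
    (b : 'I_K -> 'cV[C]_n) (s t : C) :
  (forall k, 0 <= p k) -> \sum_k p k = 1 -> 0 <= s -> 0 <= t ->
  (forall k, (a k ^t* *m a k) 0 0 <= s ^+ 2) ->
  (forall k, (b k ^t* *m b k) 0 0 <= t ^+ 2) ->
  trace_norm (\sum_k p k *: (a k *m (b k)^T)) <= s * t.
Proof.
move=> p_ge0 p1 s_ge0 t_ge0 a_le b_le; set X := \sum_k _.
have [W XW W_le] := trace_norm_dual X.
rewrite -[trace_norm X]ger0_norm ?trace_norm_ge0// -XW mulmx_suml raddf_sum.
rewrite -[s * t]mul1r -p1 mulr_suml (le_trans (ler_norm_sum _ _ _))//.
apply: ler_sum => k _ /=.
rewrite -scalemxAl mxtraceZ normrM ger0_norm// ler_wpM2l//.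
(* By cyclicity the trace of [a *m b^T *m W] is the scalar [b^T *m (W *m a)]. *)
rewrite -mulmxA mxtrace_mulC -mulmxA trace_mx11.
have sq_ge0 q (v : 'cV[C]_q) : 0 <= (v ^t* *m v) 0 0.
  by rewrite cv_sqnormE sumr_ge0// => i _; rewrite exprn_ge0.
rewrite -ler_sqr ?nnegrE ?mulr_ge0//.
rewrite (le_trans (cv_CauchySchwarz _ _))// exprMn mulrC ler_pM//.
exact: le_trans (W_le _) (a_le k).
Qed.

End TraceNorm.

(** * Length of the local coefficient vectors *)

Section LocalBound.
Context {C : numClosedFieldType}.
Local Open Scope sesquilinear_scope.

Lemma hs_innerC d (X Y : 'M[C]_d) : hs_inner X Y = (hs_inner Y X)^*.
Proof.
rewrite /hs_inner /mxtrace rmorph_sum; apply: eq_bigr => i _.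
rewrite !mxE rmorph_sum; apply: eq_bigr => j _.
by rewrite !mxE rmorphM /= conjCK mulrC.
Qed.

Lemma hs_inner_ge0 d (X : 'M[C]_d) : 0 <= hs_inner X X.
Proof.
rewrite /hs_inner /mxtrace sumr_ge0// => i _; rewrite mxE sumr_ge0// => j _.
by rewrite !mxE mulrC mul_conjC_ge0.
Qed.

(** With [Z] the orthogonal projection of [X] onto the span of [G], the residual [X - Z] is
    orthogonal to [Z], and its squared norm is the difference of the two sides. *)
Lemma hs_bessel d N (G : 'I_N -> 'M[C]_d) (X : 'M[C]_d) :
  (forall a b, hs_inner (G a) (G b) = (a == b)%:R) ->
  \sum_a `|hs_inner (G a) X| ^+ 2 <= hs_inner X X.
Proof.
move=> Gon; pose Z := \sum_a hs_inner (G a) X *: G a.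
have hsB (U V W : 'M[C]_d) : hs_inner U (V - W) = hs_inner U V - hs_inner U W.
  by rewrite /hs_inner mulmxBr raddfB.
have hsZ U : hs_inner U Z = \sum_a hs_inner (G a) X * hs_inner U (G a).
  rewrite /hs_inner mulmx_sumr raddf_sum; apply: eq_bigr => a _ /=.
  by rewrite -scalemxAr mxtraceZ.
have GZ a : hs_inner (G a) (X - Z) = 0.
  rewrite hsB hsZ (bigD1 a)//= Gon eqxx mulr1 big1 ?addr0 ?subrr// => b ba.
  by rewrite Gon eq_sym (negPf ba) mulr0.
have ZXZ : hs_inner (X - Z) Z = 0.
  by rewrite hsZ big1// => a _; rewrite (hs_innerC (X - Z)) GZ conjC0 mulr0.
have := hs_inner_ge0 (X - Z); rewrite hsB ZXZ subr0 (hs_innerC (X - Z)) hsB.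
rewrite rmorphB /= -(hs_innerC X X) hsZ rmorph_sum subr_ge0.
congr (_ <= _); apply: eq_bigr => a _.
by rewrite rmorphM /= -(hs_innerC (G a)) normCK mulrC.
Qed.

(** The eigenvalues are nonnegative with sum 1, so each is at most 1 and dominates its own
    square. *)
Lemma density_purity d (rho : 'M[C]_d) : density rho -> hs_inner rho rho <= 1.
Proof.
move=> [rho_psd tr1]; have [rho_h _] := rho_psd.
set P := spectralmx rho; set l := spectral_diag rho.
have l_ge0 i : 0 <= l 0 i by apply: spectral_diag_ge0.
have PP : P *m P ^t* = 1%:M by apply/unitarymxP/spectral_unitarymx.
have rhoE : rho = P ^t* *m diag_mx l *m P by apply: spectral_decomp.
have l1 : \sum_i l 0 i = 1.
  by rewrite -tr1 rhoE mxtrace_mulC mulmxA PP mul1mx mxtrace_diag.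
have -> : hs_inner rho rho = \sum_i l 0 i * l 0 i.
  rewrite /hs_inner -(hermsymmxP _ rho_h) rhoE -!mulmxA.
  rewrite [P *m (P ^t* *m _)]mulmxA PP mul1mx mxtrace_mulC -!mulmxA PP mulmx1.
  by rewrite mulmx_diag mxtrace_diag; apply: eq_bigr => i _; rewrite mxE.
rewrite -l1 ler_sum// => i _; rewrite ler_piMl//.
by rewrite -l1 (bigD1 i)//= lerDl sumr_ge0.
Qed.

(** Keeps the identity coordinate, which the usual Bloch vector drops. *)
Definition bloch_vector d (G : 'I_(d ^ 2) -> 'M[C]_d) (rho : 'M[C]_d) :
  'cV[C]_(d ^ 2) := \col_a \tr (rho *m G a).

Lemma density_dim_gt0 d (rho : 'M[C]_d) : density rho -> (0 < d)%N.
Proof.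
case: d rho => // rho [_]; rewrite /mxtrace big_ord0 => /eqP.
by rewrite eq_sym oner_eq0.
Qed.

Lemma scaled_bloch_sqnorm_le d (G : 'I_(d ^ 2) -> 'M[C]_d) (rho : 'M[C]_d)
    (x : C) (v := diag_first d x *m bloch_vector G rho) :
  canonical_basis G -> density rho -> 0 <= x ->
  (v ^t* *m v) 0 0 <= (d%:R - 1 + x ^+ 2) / d%:R.
Proof.
move=> [_ Gh Gon G0] rho_dens x_ge0.
have d_gt0 : (0 < d)%N := density_dim_gt0 rho_dens.
have d_neq0 : d%:R != 0 :> C by rewrite pnatr_eq0 -lt0n.
have dd_gt0 : (0 < d ^ 2)%N by rewrite expn_gt0 d_gt0.
pose o : 'I_(d ^ 2) := Ordinal dd_gt0.
have blochE a : bloch_vector G rho a 0 = hs_inner (G a) rho.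
  by rewrite mxE /hs_inner -(hermsymmxP _ (Gh a)) mxtrace_mulC.
(* Unit trace fixes the identity coordinate at [1 / sqrt d]. *)
have c0 : `|hs_inner (G o) rho| ^+ 2 = d%:R^-1.
  rewrite -blochE mxE (G0 o erefl) -scalemxAr mulmx1 mxtraceZ.
  rewrite (proj2 rho_dens) mulr1 ger0_norm ?invr_ge0 ?sqrtC_ge0 ?ler0n//.
  by rewrite exprVn sqrtCK.
have vE a : v a 0 = (if a == o then x else 1) * hs_inner (G a) rho.
  by rewrite /v /diag_first mul_diag_mx mxE blochE mxE.
have := le_trans (hs_bessel rho Gon) (density_purity rho_dens).
rewrite (bigD1 o)//= c0 => S_le.
rewrite cv_sqnormE (bigD1 o)//= vE eqxx normrM exprMn c0 (ger0_norm x_ge0).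
rewrite (eq_bigr (fun a => `|hs_inner (G a) rho| ^+ 2)); last first.
  by move=> a /negPf ao; rewrite vE ao mul1r.
(* The unscaled coordinates share at most [1 - 1/d]; the scaled one adds [x^2 / d]. *)
move: S_le; rewrite -!lerBrDl => /le_trans; apply.
by rewrite mulrDl mulrBl divff// mul1r addrK.
Qed.

End LocalBound.

(** * Correlation matrices of separable states *)

Lemma mxtrace_tens (S : comPzRingType) m n (A : 'M[S]_m) (B : 'M[S]_n) :
  \tr (A *t B) = \tr A * \tr B.
Proof.
rewrite /mxtrace mulr_sum; apply: eq_bigr => k _.
by rewrite mxE.
Qed.

(** The trace is multiplicative on tensor products, so each product state contributes a matrix of
    rank at most one. *)
Lemma can_corr_separable (C : numClosedFieldType) dA dB
    (GA : 'I_(dA ^ 2) -> 'M[C]_dA) (GB : 'I_(dB ^ 2) -> 'M[C]_dB)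
    K (p : 'I_K -> C) (rhoA : 'I_K -> 'M[C]_dA) (rhoB : 'I_K -> 'M[C]_dB) :
  can_corr GA GB (\sum_k p k *: (rhoA k *t rhoB k)) =
  \sum_k p k *: (bloch_vector GA (rhoA k) *m (bloch_vector GB (rhoB k))^T).
Proof.
apply/matrixP => a b; rewrite mxE mulmx_suml raddf_sum summxE.
apply: eq_bigr => k _ /=.
rewrite -scalemxAl mxtraceZ tensmx_mul mxtrace_tens !mxE big_ord1.
by rewrite !mxE.
Qed.

Local Open Scope complex_scope.

(** For [d >= 1] the radicand is nonnegative, so the real square root does not fall back to its
    default 0. *)
Lemma local_bound_sqr (R : realType) d (x : R) : (0 < d)%N ->
  ((local_bound d x)%:C) ^+ 2 = (d%:R - 1 + x%:C ^+ 2) / d%:R.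
Proof.
move=> d_gt0; rewrite -rmorphXn /= sqr_sqrtr; last first.
  by rewrite divr_ge0// addr_ge0 ?sqr_ge0// subr_ge0 ler1n.
by rewrite fmorph_div rmorphD rmorphB rmorphXn rmorph1 !rmorph_nat.
Qed.

Theorem theorem1 (R : realType) (dA dB : nat) (dAB : (dA <= dB)%N)
    (GA : 'I_(dA ^ 2) -> 'M[R[i]]_dA) (GB : 'I_(dB ^ 2) -> 'M[R[i]]_dB)
    (basisA : canonical_basis GA) (basisB : canonical_basis GB)
    (rho : 'M[R[i]]_(dA * dB)) (rho_density : density rho)
    (rho_sep : separable rho)
    (x y : R) (x_ge0 : 0 <= x) (y_ge0 : 0 <= y) :
  trace_norm (diag_first dA x%:C *m can_corr GA GB rho *m diag_first dB y%:C)
    <= (local_bound dA x * local_bound dB y)%:C.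
Proof.
have [K [p [rhoA [rhoB [p_ge0 p1 densA densB ->]]]]] := rho_sep.
pose a k := diag_first dA x%:C *m bloch_vector GA (rhoA k).
pose b k := diag_first dB y%:C *m bloch_vector GB (rhoB k).
have -> : diag_first dA x%:C *m
    can_corr GA GB (\sum_k p k *: (rhoA k *t rhoB k)) *m diag_first dB y%:C =
    \sum_k p k *: (a k *m (b k)^T).
  rewrite can_corr_separable mulmx_sumr mulmx_suml; apply: eq_bigr => k _.
  (* The right factor is diagonal, hence symmetric, and is absorbed into [(b k)^T]. *)
  by rewrite -scalemxAr -scalemxAl /a /b trmx_mul tr_diag_mx !mulmxA.
rewrite rmorphM /=; apply: trace_norm_convex_le => // [||k|k].
- by rewrite ler0c sqrtr_ge0.
- by rewrite ler0c sqrtr_ge0.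
- rewrite local_bound_sqr ?(density_dim_gt0 (densA k))//.
  by apply: scaled_bloch_sqnorm_le; rewrite ?ler0c.
- rewrite local_bound_sqr ?(density_dim_gt0 (densB k))//.
  by apply: scaled_bloch_sqnorm_le; rewrite ?ler0c.
Qed.
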